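(* Let $\{(X_t,c_t):t\in T\}$ be a family of pairwise disjoint fuzzy closure spaces. Then the sum $(X,c)=\big(\bigcup_{t\in T}X_t,\oplus c_t\big)$ is ČF$T_2$ if and only if each $(X_t,c_t)$ is ČF$T_2$.
   Context: $I=[0,1]$; a fuzzy (sub)set of a non-empty set $X$ is a map $f:X\to I$, and $I^X$ is the set of all of them, ordered pointwise, with $\vee,\wedge$ pointwise supremum/infimum. $\underline 0$ is the constant $0$ fuzzy set; $1_A$ is the characteristic function of $A\subseteq X$; the complement is $\mathfrak{Co}(f)(x)=1-f(x)$. For $x\in X$ and $0<\lambda\le1$, the fuzzy point $x_\lambda$ has value $\lambda$ at $x$ and $0$ elsewhere; $x_\lambda\in f$ means $x_\lambda\le f$, i.e. $\lambda\le f(x)$. Fuzzy points $x_\lambda,y_\gamma$ are distinct if $x\ne y$. A fuzzy closure space is a pair $(X,c)$ with $X$ a non-empty set and $c:I^X\to I^X$ satisfying $c(\underline 0)=\underline 0$, $f\le c(f)$, and $c(f\vee g)=c(f)\vee c(g)$ for all $f,g\in I^X$ (idempotency is not required). Sum: if the sets $X_t$ are pairwise disjoint, $X=\bigcup_{t\in T}X_t$ and $\oplus c_t(f)=\bigvee_{t\in T}c_t(1_{X_t}\wedge f)$ for $f\in I^X$, where $1_{X_t}\wedge f$ is regarded as a fuzzy subset of $X_t$ and $c_t(\cdot)\in I^{X_t}$ is extended by $0$ to $X$. The interior is $\operatorname{int}(f)=\mathfrak{Co}(c(\mathfrak{Co}(f)))$; $f$ is a neighborhood of a fuzzy point $x_\lambda$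 if $x_\lambda\le\operatorname{int}(f)$. $(X,c)$ is ČF$T_2$ if for every two distinct fuzzy points $x_\lambda,y_\gamma$ there are neighborhoods $f$ of $x_\lambda$ and $g$ of $y_\gamma$ such that $f\le\mathfrak{Co}(g)$, $x_\lambda\in f\le\mathfrak{Co}(y_\gamma)$ and $y_\gamma\in g\le\mathfrak{Co}(x_\lambda)$. *)

(* Defs.v *)
From HB Require Import structures.
From mathcomp Require Import all_boot all_order all_algebra.
From mathcomp Require Import all_classical all_reals interval_inference.

Set Implicit Arguments.
Unset Strict Implicit.
Unset Printing Implicit Defensive.

Import Order.TTheory GRing.Theory Num.Theory.

Local Open Scope ring_scope.
Local Open Scope classical_set_scope.

(* On fuzzy sets, [f <= g], [f `|` g] and [f `&` g] with the delimiter %O are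
   the pointwise order and lattice operations that boolp provides for functions
   into an ordered type. *)
Definition fuzzy_set (R : realType) (X : Type) : Type := X -> {i01 R}.

Definition fuzzy0 (R : realType) (X : Type) : fuzzy_set R X :=
  fun _ => 0%:i01.

Definition fuzzy_char (R : realType) (X : Type) (A : set X) : fuzzy_set R X :=
  fun x => if x \in A then 1%:i01 else 0%:i01.

Definition fuzzy_compl (R : realType) (X : Type) (f : fuzzy_set R X) :
    fuzzy_set R X :=
  fun x => (1 - (f x)%:num)%:i01.

Definition fuzzy_point (R : realType) (X : Type) (x : X) (l : {i01 R}) :
    fuzzy_set R X :=
  fun y => if `[< y = x >] then l else 0%:i01.

Lemma sup_i01_ge0 (R : realType) (A : set {i01 R}) :
  0 <= sup [set a%:num | a in A].
Proof.
have [[a Aa]|A0] := pselect (A !=set0); last first.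
  by move/set0P/negP/negPn/eqP: A0 => ->; rewrite image_set0 sup0.
apply: (@le_trans _ _ a%:num) => //; apply: ub_le_sup; last by exists a.
by exists 1 => _ [b _ <-].
Qed.

Lemma sup_i01_le1 (R : realType) (A : set {i01 R}) :
  sup [set a%:num | a in A] <= 1.
Proof.
have [[a Aa]|A0] := pselect (A !=set0); last first.
  by move/set0P/negP/negPn/eqP: A0 => ->; rewrite image_set0 sup0.
by apply: ge_sup; [exists a%:num, a | move=> _ [b _ <-]].
Qed.

(* Supremum in the complete lattice [0, 1]; since [sup set0 = 0] in the reals,
   this is the least upper bound for the empty set as well. *)
Definition i01_sup (R : realType) (A : set {i01 R}) : {i01 R} :=
  Itv01 (sup_i01_ge0 A) (sup_i01_le1 A).

Definition fuzzy_sup (R : realType) (T X : Type) (F : T -> fuzzy_set R X) :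
    fuzzy_set R X :=
  fun x => i01_sup [set F t x | t in [set: T]].

Lemma fuzzy_sup_ub (R : realType) (T X : Type) (F : T -> fuzzy_set R X) t :
  (F t <= fuzzy_sup F)%O.
Proof.
apply/asboolP => x.
have : (F t x)%:num <= (fuzzy_sup F x)%:num; last by [].
apply: ub_le_sup; last by exists (F t x) => //; exists t.
by exists 1 => _ [b _ <-].
Qed.

Lemma fuzzy_sup_le (R : realType) (T X : Type) (F : T -> fuzzy_set R X)
    (g : fuzzy_set R X) :
  (forall t, (F t <= g)%O) -> (fuzzy_sup F <= g)%O.
Proof.
move=> Fg; apply/asboolP => x.
have : (fuzzy_sup F x)%:num <= (g x)%:num; last by [].
have [[t _]|T0] := pselect ([set: T] !=set0).
  apply: ge_sup; first by exists (F t x)%:num, (F t x) => //; exists t.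
  by move=> _ [_ [s _ <-] <-]; have /asboolP := Fg s; apply.
by move/set0P/negP/negPn/eqP: T0; rewrite /fuzzy_sup /= => ->; rewrite !image_set0 sup0.
Qed.

Record is_fuzzy_closure_space (R : realType) (X : Type)
    (c : fuzzy_set R X -> fuzzy_set R X) : Prop := IsFuzzyClosureSpace {
  fcs_nonempty : inhabited X ;
  fcs_zero : c (@fuzzy0 R X) = @fuzzy0 R X ;
  fcs_extensive : forall f, (f <= c f)%O ;
  fcs_join : forall f g, c (f `|` g)%O = (c f `|` c g)%O }.

Section separation.
Variables (R : realType) (X : Type) (c : fuzzy_set R X -> fuzzy_set R X).

Definition fuzzy_int (f : fuzzy_set R X) : fuzzy_set R X :=
  fuzzy_compl (c (fuzzy_compl f)).

Definition fuzzy_nbhd (f : fuzzy_set R X) (x : X) (l : {i01 R}) : Prop :=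
  (fuzzy_point x l <= fuzzy_int f)%O.

Definition CFT2 : Prop :=
  forall (x y : X) (l m : {i01 R}), 0 < l%:num -> 0 < m%:num -> x <> y ->
  exists f g : fuzzy_set R X,
    fuzzy_nbhd f x l /\ fuzzy_nbhd g y m /\
    (f <= fuzzy_compl g)%O /\
    (fuzzy_point x l <= f)%O /\ (f <= fuzzy_compl (fuzzy_point y m))%O /\
    (fuzzy_point y m <= g)%O /\ (g <= fuzzy_compl (fuzzy_point x l))%O.

End separation.

(* A set [A : set U], used as a type, is the type of its elements, so that a
   fuzzy subset of [A] is a term of type [fuzzy_set R A]. *)
Definition subset_incl (U : Type) (A B : set U) (AB : A `<=` B) (x : A) : B :=
  exist _ (val x) (mem_set (AB _ (set_mem (valP x)))).

Definition fuzzy_restrict (R : realType) (U : Type) (A B : set U)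
    (AB : A `<=` B) (f : fuzzy_set R B) : fuzzy_set R A :=
  fun x => f (subset_incl AB x).

Definition fuzzy_extend (R : realType) (U : Type) (A B : set U)
    (f : fuzzy_set R A) : fuzzy_set R B :=
  fun x => if (insub (val x) : option A) is Some y then f y else 0%:i01.

Section sum.
Variables (R : realType) (T U : Type) (X : T -> set U).
Variable c : forall t, fuzzy_set R (X t) -> fuzzy_set R (X t).

Definition summand (t : T) : set (\bigcup_s X s) := [set x | X t (val x)].

Lemma summand_sub (t : T) : X t `<=` \bigcup_s X s.
Proof. exact: (@bigcup_sup _ _ t setT X I). Qed.

Definition fuzzy_sum (f : fuzzy_set R (\bigcup_s X s)) :
    fuzzy_set R (\bigcup_s X s) :=
  fuzzy_sup (fun t => fuzzy_extend (B := \bigcup_s X s)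
    (c (fuzzy_restrict (@summand_sub t)
          (@fuzzy_char R _ (summand t) `&` f)%O))).

End sum.

(* Main.v *)
(** For [x] in [X t] the sum closure satisfies [c f x = c_t (f restricted to X t) x],
    so being a neighborhood of [x] in the sum only depends on the restriction to
    [X t]. Separating fuzzy sets of the sum therefore restrict to each summand,
    those of a summand extend by zero, and two points of different summands are
    separated by the characteristic functions of these summands, which are
    clopen. *)
Require Import Defs.
From HB Require Import structures.
From mathcomp Require Import all_boot all_order all_algebra.
From mathcomp Require Import all_classical all_reals interval_inference.

Local Open Scope classical_set_scope.

Import Order.TTheory GRing.Theory Num.Theory.

Local Open Scope ring_scope.

Section fuzzy_order.
Context {R : realType} {X : Type}.
Implicit Types (f g : fuzzy_set R X) (x y : X) (l m : {i01 R}).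

Lemma fuzzy_leP f g :
  (f <= g)%O <-> forall x, (f x)%:num <= (g x)%:num.
Proof. by split=> [/asboolP|fg]; [apply | apply/asboolP]. Qed.

Lemma fuzzy_pointE x l : fuzzy_point x l x = l.
Proof. by rewrite /fuzzy_point asboolT. Qed.

Lemma fuzzy_point_leP x l f :
  (fuzzy_point x l <= f)%O <-> l%:num <= (f x)%:num.
Proof.
split=> [/fuzzy_leP/(_ x)|lf]; first by rewrite fuzzy_pointE.
by apply/fuzzy_leP => y; rewrite /fuzzy_point; case: asboolP => [->|_] /=.
Qed.

Lemma fuzzy_le_complC f g : (f <= fuzzy_compl g)%O -> (g <= fuzzy_compl f)%O.
Proof.
move=> /fuzzy_leP fg; apply/fuzzy_leP => x.
by have /= := fg x; rewrite !lerBrDl addrC.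
Qed.

(** Away from [x] the complement of the fuzzy point is constantly 1, so only the value of [f] at [x]
    is constrained. *)
Lemma fuzzy_le_compl_pointP x l f :
  (f <= fuzzy_compl (fuzzy_point x l))%O <-> (f x)%:num <= 1 - l%:num.
Proof.
split=> [/fuzzy_leP/(_ x)|fx]; first by rewrite /= fuzzy_pointE.
apply/fuzzy_le_complC/fuzzy_point_leP.
by rewrite /= lerBrDl addrC -lerBrDl.
Qed.

Lemma fuzzy_nbhdP (c : fuzzy_set R X -> fuzzy_set R X) f x l :
  fuzzy_nbhd c f x l <-> l%:num <= 1 - (c (fuzzy_compl f) x)%:num.
Proof. exact: fuzzy_point_leP. Qed.

Lemma fuzzy_compl_char1 (A : set X) x :
  A x -> fuzzy_compl (fuzzy_char R A) x = 0%:i01.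
Proof.
by move=> Ax; apply/val_inj; rewrite /= /fuzzy_char mem_set//= subrr.
Qed.

Lemma fuzzy_charT (A : set X) x : A x -> fuzzy_char R A x = 1%:i01.
Proof. by move=> Ax; rewrite /fuzzy_char mem_set. Qed.

Lemma fuzzy_charF (A : set X) x : ~ A x -> fuzzy_char R A x = 0%:i01.
Proof. by move=> Ax; rewrite /fuzzy_char memNset. Qed.

End fuzzy_order.

Section restrict_extend.
Context {R : realType} {U : Type} {A B : set U} (AB : A `<=` B).

Lemma fuzzy_extendT (f : fuzzy_set R A) (x : A) :
  fuzzy_extend (B := B) f (subset_incl AB x) = f x.
Proof. by rewrite /fuzzy_extend /= valK. Qed.

Lemma fuzzy_extendF (f : fuzzy_set R A) (z : B) :
  ~ A (val z) -> fuzzy_extend f z = 0%:i01.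
Proof. by move=> Az; rewrite /fuzzy_extend insubF// memNset. Qed.

Lemma fuzzy_extendK (f : fuzzy_set R A) :
  fuzzy_restrict AB (fuzzy_extend f) = f.
Proof. by apply/funext => x; exact: fuzzy_extendT. Qed.

(** Outside [A] both extensions vanish, and the inequality reads [0 <= 1 - 0]. *)
Lemma fuzzy_extend_le_compl (f g : fuzzy_set R A) :
  (f <= fuzzy_compl g)%O ->
  (fuzzy_extend (B := B) f <= fuzzy_compl (fuzzy_extend g))%O.
Proof.
move=> /fuzzy_leP fg; apply/fuzzy_leP => z; rewrite /fuzzy_extend /=.
by case: insubP => [u _ _|_] /=; [exact: fg | rewrite subr0].
Qed.

Lemma subset_incl_inj : injective (subset_incl AB).
Proof. by move=> x y [] /val_inj. Qed.

End restrict_extend.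

Section sum.
Context {R : realType} {T U : Type} {X : T -> set U}.
Context (c : forall t, fuzzy_set R (X t) -> fuzzy_set R (X t)).
Hypothesis Xdisj : trivIset [set: T] X.

Local Notation incl t := (subset_incl (@summand_sub T U X t)).
Local Notation restrict t := (fuzzy_restrict (@summand_sub T U X t)).

Lemma bigcup_inclP (z : \bigcup_s X s) : exists t (x : X t), z = incl t x.
Proof.
have [t _ Xtz] := set_mem (valP z).
by exists t, (exist _ (val z) (mem_set Xtz)); exact: val_inj.
Qed.

Lemma restrict_summand t (f : fuzzy_set R (\bigcup_s X s)) :
  restrict t (@fuzzy_char R _ (@summand T U X t) `&` f)%O = restrict t f.
Proof.
apply/funext => x; rewrite /fuzzy_restrict meetfE fuzzy_charT.
  by apply/meet_idPr; have : (f (incl t x))%:num <= 1 by [].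
by exact: set_mem (valP x).
Qed.

(** By disjointness only the term of index [t] can be nonzero at a point of [X t], so the supremum
    is attained there. *)
Lemma fuzzy_sumE t (f : fuzzy_set R (\bigcup_s X s)) (x : X t) :
  fuzzy_sum c f (incl t x) = c t (restrict t f) x.
Proof.
pose F s := fuzzy_extend (B := \bigcup_s X s)
  (c s (restrict s (@fuzzy_char R _ (@summand T U X s) `&` f)%O)).
have Ft : F t (incl t x) = c t (restrict t f) x.
  by rewrite /F fuzzy_extendT restrict_summand.
rewrite -Ft; apply/val_inj/le_anti/andP; split; last first.
  by have /fuzzy_leP := fuzzy_sup_ub F t; exact.
apply: ge_sup; first by exists (F t (incl t x))%:num, (F t (incl t x)) => //; exists t.
move=> _ [_ [s _ <-] <-].
have [Xsx|nXsx] := pselect (X s (val x)).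
  (* The point lies in both [X s] and [X t], so disjointness identifies the indices. *)
  have -> // : s = t.
  by apply: Xdisj => //; exists (val x); split => //; exact: set_mem (valP x).
by rewrite (fuzzy_extendF _ (incl t x) nXsx) /=.
Qed.

(** Restriction commutes with complement by conversion, so [fuzzy_sumE] turns either interior value
    into the other. *)
Lemma fuzzy_nbhd_sumP t (f : fuzzy_set R (\bigcup_s X s)) (x : X t) l :
  fuzzy_nbhd (fuzzy_sum c) f (incl t x) l <->
  fuzzy_nbhd (c t) (restrict t f) x l.
Proof.
by split=> /fuzzy_nbhdP fx; apply/fuzzy_nbhdP; move: fx; rewrite fuzzy_sumE.
Qed.

(** Restricting a separating pair works: the order conditions are pointwise, and those on fuzzy
    points only concern values at [x] and [y]. *)
Lemma CFT2_summand t : CFT2 (fuzzy_sum c) -> CFT2 (c t).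
Proof.
move=> sumT2 x y l m l0 m0 xy.
have ixy : incl t x <> incl t y by move/subset_incl_inj.
have [f [g [fx [gy [fg [xf [fy [yg gx]]]]]]]] := sumT2 _ _ l m l0 m0 ixy.
exists (restrict t f), (restrict t g).
split; first exact/fuzzy_nbhd_sumP.
split; first exact/fuzzy_nbhd_sumP.
split; first by apply/fuzzy_leP => z; have /fuzzy_leP := fg; exact.
split; first by apply/fuzzy_point_leP; move/fuzzy_point_leP : xf.
split; first by apply/fuzzy_le_compl_pointP; move/fuzzy_le_compl_pointP : fy.
split; first by apply/fuzzy_point_leP; move/fuzzy_point_leP : yg.
by apply/fuzzy_le_compl_pointP; move/fuzzy_le_compl_pointP : gx.
Qed.

Hypothesis Xspace : forall t, is_fuzzy_closure_space (c t).

(** On [X t] the characteristic function is 1, so its complement is the zero fuzzy set, which [c t]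
    fixes; the interior is therefore 1 at [x], above any [l]. *)
Lemma fuzzy_nbhd_summand t (x : X t) l :
  fuzzy_nbhd (fuzzy_sum c) (fuzzy_char R (@summand T U X t)) (incl t x) l.
Proof.
apply/fuzzy_nbhd_sumP/fuzzy_nbhdP.
have -> : fuzzy_compl (restrict t (fuzzy_char R (@summand T U X t))) =
    @fuzzy0 R (X t).
  apply/funext => y; apply: (fuzzy_compl_char1 _ (incl t y)).
  exact: set_mem (valP y).
by rewrite (fcs_zero (Xspace t)) /= subr0.
Qed.

Lemma CFT2_fuzzy_sum : (forall t, CFT2 (c t)) -> CFT2 (fuzzy_sum c).
Proof.
move=> cT2 z w l m l0 m0.
have [t [x ->]] := bigcup_inclP z; have [s [y ->]] := bigcup_inclP w => xy.
have [ts|ts] := pselect (t = s).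
  subst s.
  have xy' : x <> y by move=> e; apply: xy; rewrite e.
  have [f [g [fx [gy [fg [xf [fy [yg gx]]]]]]]] := cT2 t _ _ l m l0 m0 xy'.
  (* Same summand: restricting the zero extensions gives back [f] and [g], and their values at the
     two points are unchanged. *)
  exists (fuzzy_extend f), (fuzzy_extend g).
  split; first by apply/fuzzy_nbhd_sumP; rewrite fuzzy_extendK.
  split; first by apply/fuzzy_nbhd_sumP; rewrite fuzzy_extendK.
  split; first exact: fuzzy_extend_le_compl.
  split; first by apply/fuzzy_point_leP; rewrite fuzzy_extendT; exact/fuzzy_point_leP.
  split.
    by apply/fuzzy_le_compl_pointP; rewrite fuzzy_extendT; exact/fuzzy_le_compl_pointP.
  split; first by apply/fuzzy_point_leP; rewrite fuzzy_extendT; exact/fuzzy_point_leP.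
  by apply/fuzzy_le_compl_pointP; rewrite fuzzy_extendT; exact/fuzzy_le_compl_pointP.
have XtXs u : X t u -> X s u -> False.
  by move=> Xtu Xsu; apply: ts; apply: Xdisj => //; exists u.
have Xtx : @summand T U X t (incl t x) by exact: set_mem (valP x).
have Xsy : @summand T U X s (incl s y) by exact: set_mem (valP y).
have nXty : ~ @summand T U X t (incl s y) by move=> /XtXs; apply.
have nXsx : ~ @summand T U X s (incl t x) by move/XtXs; apply.
(* Different summands: each characteristic function is 1 at its own point and 0 at the other, so the
   point conditions reduce to [l] and [m] being at most 1. *)
exists (fuzzy_char R (@summand T U X t)), (fuzzy_char R (@summand T U X s)).
split; first exact: fuzzy_nbhd_summand.
split; first exact: fuzzy_nbhd_summand.
split.
  apply/fuzzy_leP => u /=.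
  (* Off [X t] the left side is 0; on [X t] the point is not in [X s], so the right side is 1. *)
  have [Xtu|nXtu] := pselect (@summand T U X t u); last by rewrite (fuzzy_charF _ _ nXtu) /= subr_ge0.
  by rewrite (@fuzzy_charF _ _ (@summand T U X s)) /= ?subr0// => /(XtXs _ Xtu).
split; first by apply/fuzzy_point_leP; rewrite fuzzy_charT //=.
split; first by apply/fuzzy_le_compl_pointP; rewrite fuzzy_charF //= subr_ge0.
split; first by apply/fuzzy_point_leP; rewrite fuzzy_charT //=.
by apply/fuzzy_le_compl_pointP; rewrite fuzzy_charF //= subr_ge0.
Qed.

End sum.

Local Close Scope ring_scope.

Theorem theorem6p5 (R : realType) (T U : Type) (X : T -> set U)
    (c : forall t : T, fuzzy_set R (X t) -> fuzzy_set R (X t))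
    (Xdisj : trivIset [set: T] X)
    (Xspace : forall t : T, is_fuzzy_closure_space (c t)) :
  CFT2 (fuzzy_sum c) <-> (forall t : T, CFT2 (c t)).
Proof.
split=> [sumT2 t|]; first exact: CFT2_summand sumT2.
exact: CFT2_fuzzy_sum.
Qed.
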